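(* Let $(\mathcal{A},\Delta,\epsilon,\Phi,\mathcal{R})$ be a quasi-triangular quasi-bialgebra over a field $k$ and let $\mathcal{F}\in\mathcal{A}\otimes\mathcal{A}$ be an invertible element (no condition is imposed on $(\epsilon\otimes\mathrm{id})\mathcal{F}$ or $(\mathrm{id}\otimes\epsilon)\mathcal{F}$). Let $\Delta_{\mathcal{F}}:\mathcal{A}\to\mathcal{A}\otimes\mathcal{A}$, $\Phi_{\mathcal{F}}\in\mathcal{A}^{\otimes3}$ and $\mathcal{R}_{\mathcal{F}}\in\mathcal{A}\otimes\mathcal{A}$ be determined by $$\Delta_{\mathcal{F}}(a)=\mathcal{F}\Delta(a)\mathcal{F}^{-1}\quad\text{for all }a\in\mathcal{A},$$ $$\Phi_{\mathcal{F}}\,(\mathcal{F}\otimes1)\big((\Delta\otimes\mathrm{id})\mathcal{F}\big)=(1\otimes\mathcal{F})\big((\mathrm{id}\otimes\Delta)\mathcal{F}\big)\Phi,$$ $$\mathcal{R}_{\mathcal{F}}=\mathcal{F}^{(op)}\,\mathcal{R}\,\mathcal{F}^{-1},$$ where $\mathcal{F}^{(op)}=\sigma(\mathcal{F})$ and $\sigma$ is the flip of the two tensor factors. Then $(\mathcal{A},\Delta_{\mathcal{F}},\epsilon,\Phi_{\mathcal{F}},\mathcal{R}_{\mathcal{F}})$ is also a quasi-triangular quasi-bialgebra.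
   Context: **Quasi-bialgebra.** $k$ is a field. A quasi-bialgebra $(\mathcal{A},\Delta,\epsilon,\Phi,c_r,c_l)$ is a unital associative $k$-algebra $\mathcal{A}$ with (unital) algebra homomorphisms $\Delta:\mathcal{A}\to\mathcal{A}\otimes\mathcal{A}$ and $\epsilon:\mathcal{A}\to k$, an invertible $\Phi\in\mathcal{A}\otimes\mathcal{A}\otimes\mathcal{A}$ (associator) and invertible $c_l,c_r\in\mathcal{A}$ (unit constraints) such that: (i) $(\mathrm{id}\otimes\Delta)\Delta(a)=\Phi\,\big((\Delta\otimes\mathrm{id})\Delta(a)\big)\,\Phi^{-1}$ for all $a\in\mathcal{A}$; (ii) $\big((\mathrm{id}\otimes\mathrm{id}\otimes\Delta)\Phi\big)\big((\Delta\otimes\mathrm{id}\otimes\mathrm{id})\Phi\big)=(1\otimes\Phi)\big((\mathrm{id}\otimes\Delta\otimes\mathrm{id})\Phi\big)(\Phi\otimes1)$; (iii) $(\epsilon\otimes\mathrm{id})\Delta(a)=c_l^{-1}ac_l$ and $(\mathrm{id}\otimes\epsilon)\Delta(a)=c_r^{-1}ac_r$ for all $a\in\mathcal{A}$; (iv) $(\mathrm{id}\otimes\epsilon\otimes\mathrm{id})\Phi=c_r\otimes c_l^{-1}$. **Normalization.** Rescaling $c_l,c_r$ to $\epsilon(c_l^{-1})c_l,\ \epsilon(c_r^{-1})c_r$ preserves the axioms, so it is always assumed that $\epsilon(c_l)=\epsilon(c_r)=1$; then $c_l^{-1}=(\epsilon\otimes\epsilon\otimes\mathrm{id})\Phi$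 and $c_r=(\mathrm{id}\otimes\epsilon\otimes\epsilon)\Phi$, so the unit constraints are determined by $\Phi$, and a quasi-bialgebra is specified by $(\mathcal{A},\Delta,\epsilon,\Phi)$ (the axioms being imposed with $c_l,c_r$ given by these formulas). **Index notation.** For $A=\sum_j a_j\otimes b_j$, $A_{ij}$ denotes the element of $\mathcal{A}^{\otimes3}$ with the first leg of $A$ in slot $i$, the second leg in slot $j$, and $1$ in the remaining slot. For $\Phi=\sum_j x_j\otimes y_j\otimes z_j$ and $\{i,j,k\}=\{1,2,3\}$, $\Phi_{ijk}$ has the first leg in slot $i$, the second in slot $j$, the third in slot $k$ (so $\Phi_{123}=\Phi$). **Quasi-triangularity.** Let $\Delta^{(op)}=\sigma\circ\Delta$. $(\mathcal{A},\Delta,\epsilon,\Phi,\mathcal{R})$ is a quasi-triangular quasi-bialgebra if $(\mathcal{A},\Delta,\epsilon,\Phi)$ is a quasi-bialgebra and $\mathcal{R}\in\mathcal{A}\otimes\mathcal{A}$ is invertible with (a) $\Delta^{(op)}(a)\mathcal{R}=\mathcal{R}\Delta(a)$ for all $a\in\mathcal{A}$; (b) $(\mathrm{id}\otimes\Delta)\mathcal{R}=\Phi_{231}^{-1}\mathcal{R}_{13}\Phi_{213}\mathcal{R}_{12}\Phi_{123}^{-1}$; (c) $(\Delta\otimes\mathrm{id})\mathcal{R}=\Phi_{312}\mathcal{R}_{13}\Phi_{132}^{-1}\mathcal{R}_{23}\Phi_{123}$. *)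

(* Defs.v *)
From HB Require Import structures.
From mathcomp Require Import all_boot all_order all_algebra.
From mathcomp Require Import boolp classical_sets.

Set Implicit Arguments.
Unset Strict Implicit.
Unset Printing Implicit Defensive.

Import GRing.Theory.
Local Open Scope ring_scope.
Local Open Scope quotient_scope.

Reserved Notation "x ⊗ y" (at level 38, left associativity).

(* The tensor product over k is the free commutative monoid on V * W (finite  *)
(* formal sums, as lists) modulo the tensor relations. Scalars need not be    *)
(* recorded, as c(v ⊗ w) = (cv) ⊗ w.                                          *)
Inductive tens_rel (k : fieldType) (V W : lmodType k) :
    seq (V * W) -> seq (V * W) -> Prop :=
  | tens_refl s : tens_rel s s
  | tens_sym s t : tens_rel s t -> tens_rel t s
  | tens_trans s t u : tens_rel s t -> tens_rel t u -> tens_rel s u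
  | tens_cat s s' t t' :
      tens_rel s s' -> tens_rel t t' -> tens_rel (s ++ t) (s' ++ t')
  | tens_catC s t : tens_rel (s ++ t) (t ++ s)
  | tens_0l w : tens_rel [:: (0, w)] [::]
  | tens_Dl v v' w : tens_rel [:: (v + v', w)] [:: (v, w); (v', w)]
  | tens_Dr v w w' : tens_rel [:: (v, w + w')] [:: (v, w); (v, w')]
  | tens_Z c v w : tens_rel [:: (c *: v, w)] [:: (v, c *: w)].

(* The construction only uses the vector space structure; it is indexed by    *)
(* algebras so that unification stays fast on iterated tensor powers.         *)
Section TensorSpace.
Variables (k : fieldType) (V W : algType k).

Definition tens_eqb (s t : seq (V * W)) : bool := `[< tens_rel s t >].

Lemma tens_eqb_equiv : equiv_class_of tens_eqb.
Proof.
split=> [s|s t|s t u].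
- exact/asboolP/tens_refl.
- by apply/asboolP/asboolP => /tens_sym.
- by move=> /asboolP st /asboolP tu; apply/asboolP/(tens_trans st tu).
Qed.

Canonical tens_equiv := EquivRelPack tens_eqb_equiv.

Definition tens : Type := {eq_quot tens_equiv}.
HB.instance Definition _ := Choice.on tens.
HB.instance Definition _ := Quotient.on tens.

Definition tpure (v : V) (w : W) : tens := \pi_tens [:: (v, w)].

(* The additive map on V ⊗ W induced by a function of two arguments; it is    *)
(* meaningful only when f is bilinear (see tlift_pure).                       *)
Definition tlift (Z : zmodType) (f : V -> W -> Z) (t : tens) : Z :=
  \sum_(p <- repr t) f p.1 p.2.

Lemma tens_eqP (s t : seq (V * W)) : tens_rel s t <-> \pi_tens s = \pi_tens t.
Proof. by split=> [st|/eqmodP/asboolP//]; apply/eqmodP/asboolP. Qed.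

Lemma tens_piW (P : tens -> Prop) :
  (forall s : seq (V * W), P (\pi_tens s)) -> forall x, P x.
Proof. by move=> Ppi x; rewrite -[x]reprK; exact: Ppi. Qed.

Definition tzero : tens := \pi_tens [::].
Definition tadd (x y : tens) : tens := \pi_tens (repr x ++ repr y).
Definition tscale (c : k) (x : tens) : tens :=
  \pi_tens [seq (c *: p.1, p.2) | p <- repr x].
Definition topp (x : tens) : tens := tscale (-1) x.

Lemma tadd_pi s t : tadd (\pi_tens s) (\pi_tens t) = \pi_tens (s ++ t).
Proof. by apply/tens_eqP/tens_cat; apply/tens_eqP; rewrite reprK. Qed.

Lemma tens_scale c (s t : seq (V * W)) : tens_rel s t ->
  tens_rel [seq (c *: p.1, p.2) | p <- s] [seq (c *: p.1, p.2) | p <- t].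
Proof.
elim=> {s t} /=.
- by move=> s; exact: tens_refl.
- by move=> s t _; exact: tens_sym.
- by move=> s t u _ st _; exact: tens_trans.
- by move=> s s' t t' _ ss _ tt; rewrite !map_cat; exact: tens_cat.
- by move=> s t; rewrite !map_cat; exact: tens_catC.
- by move=> w; rewrite scaler0; exact: tens_0l.
- by move=> v v' w; rewrite scalerDr; exact: tens_Dl.
- by move=> v w w'; exact: tens_Dr.
- by move=> d v w; rewrite scalerA mulrC -scalerA; exact: tens_Z.
Qed.

Lemma tscale_pi c s :
  tscale c (\pi_tens s) = \pi_tens [seq (c *: p.1, p.2) | p <- s].
Proof. by apply/tens_eqP/tens_scale/tens_eqP; rewrite reprK. Qed.

Lemma taddA : associative tadd.
Proof.
move=> x y z; elim/tens_piW: x => s; elim/tens_piW: y => t; elim/tens_piW: z => u.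
by rewrite !tadd_pi catA.
Qed.

Lemma taddC : commutative tadd.
Proof.
move=> x y; elim/tens_piW: x => s; elim/tens_piW: y => t; rewrite !tadd_pi.
exact/tens_eqP/tens_catC.
Qed.

Lemma tadd0 : left_id tzero tadd.
Proof. by move=> x; elim/tens_piW: x => s; rewrite tadd_pi. Qed.

Lemma taddN : left_inverse tzero topp tadd.
Proof.
move=> x; elim/tens_piW: x => s; rewrite /topp tscale_pi tadd_pi; apply/tens_eqP.
elim: s => [|[v w] s IHs] /=; first exact: tens_refl.
have H : tens_rel [:: (-1 *: v, w); (v, w)] [::].
  apply: tens_trans (tens_sym (tens_Dl _ _ _)) _.
  by rewrite scaleN1r addNr; exact: tens_0l.
set s' := map _ s.
have E : tens_rel (s' ++ (v, w) :: s) ([:: (v, w)] ++ (s' ++ s)).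
  rewrite -[(v, w) :: s]cat1s !catA.
  by apply: tens_cat (tens_refl _); exact: tens_catC.
apply: (tens_trans (tens_cat (tens_refl [:: (-1 *: v, w)]) E)).
rewrite catA -[[::]]cats0.
exact: tens_cat H IHs.
Qed.

HB.instance Definition _ :=
  GRing.isZmodule.Build tens taddA taddC tadd0 taddN.

Lemma tscaleA a b x : tscale a (tscale b x) = tscale (a * b) x.
Proof.
elim/tens_piW: x => s; rewrite !tscale_pi -map_comp; congr (\pi_tens _).
by apply: eq_map => -[v w] /=; rewrite scalerA.
Qed.

Lemma tscale1 : left_id 1 tscale.
Proof.
move=> x; elim/tens_piW: x => s; rewrite tscale_pi; congr (\pi_tens _).
by rewrite -[RHS]map_id; apply: eq_map => -[v w] /=; rewrite scale1r.
Qed.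

Lemma tscaleDr : right_distributive tscale tadd.
Proof.
move=> c x y; elim/tens_piW: x => s; elim/tens_piW: y => t.
by rewrite tadd_pi !tscale_pi tadd_pi map_cat.
Qed.

Lemma tscaleDl x a b : tscale (a + b) x = tadd (tscale a x) (tscale b x).
Proof.
elim/tens_piW: x => s; rewrite !tscale_pi tadd_pi.
apply/tens_eqP; elim: s => [|[v w] s IHs] /=; first exact: tens_refl.
set sa := [seq (a *: p.1, p.2) | p <- s] in IHs *.
set sb := [seq (b *: p.1, p.2) | p <- s] in IHs *.
rewrite -cat1s; apply: (tens_trans (tens_cat _ IHs)).
  by rewrite scalerDl; exact: tens_Dl.
have E : tens_rel ([:: (b *: v, w)] ++ (sa ++ sb)) (sa ++ [:: (b *: v, w)] ++ sb).
  by rewrite !catA; apply: tens_cat (tens_refl _); exact: tens_catC.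
exact: (tens_cat (tens_refl [:: (a *: v, w)]) E).
Qed.

HB.instance Definition _ := GRing.Zmodule_isLmodule.Build k tens
  tscaleA tscale1 tscaleDr tscaleDl.

Lemma tpi_sum s : \pi_tens s = \sum_(p <- s) tpure p.1 p.2.
Proof.
elim: s => [|[v w] s IHs]; first by rewrite big_nil.
by rewrite big_cons -IHs; exact/esym/tadd_pi.
Qed.

Lemma tens_sum (t : tens) : t = \sum_(p <- repr t) tpure p.1 p.2.
Proof. by rewrite -tpi_sum reprK. Qed.

Lemma tens_ind (P : tens -> Prop) : P 0 -> (forall v w, P (tpure v w)) ->
  (forall x y, P x -> P y -> P (x + y)) -> forall t, P t.
Proof.
move=> P0 Pp PD t; rewrite [t]tens_sum.
by elim/big_ind: _ => // -[v w] _; exact: Pp.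
Qed.

Lemma tpureDl v v' w : tpure (v + v') w = tpure v w + tpure v' w.
Proof. by apply/esym/(etrans (tadd_pi _ _))/esym/tens_eqP/tens_Dl. Qed.

Lemma tpureDr v w w' : tpure v (w + w') = tpure v w + tpure v w'.
Proof. by apply/esym/(etrans (tadd_pi _ _))/esym/tens_eqP/tens_Dr. Qed.

Lemma tpureZl c v w : tpure (c *: v) w = c *: tpure v w.
Proof. by rewrite /GRing.scale /= tscale_pi. Qed.

Lemma tpureZr c v w : tpure v (c *: w) = c *: tpure v w.
Proof. by rewrite -tpureZl; apply/esym/tens_eqP/tens_Z. Qed.

Lemma tpure0l w : tpure 0 w = 0.
Proof. exact/tens_eqP/tens_0l. Qed.

Lemma tpure0r v : tpure v 0 = 0.
Proof. by rewrite -(scale0r 0) tpureZr scale0r. Qed.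

(* Biadditive and k-balanced: this is what makes tlift f well defined.        *)
Definition balanced (Z : zmodType) (f : V -> W -> Z) : Prop :=
  [/\ forall v v' w, f (v + v') w = f v w + f v' w,
      forall v w w', f v (w + w') = f v w + f v w' &
      forall c v w, f (c *: v) w = f v (c *: w)].

Section Lift.
Variables (Z : zmodType) (f : V -> W -> Z).

Lemma tlift_is_additive : {morph tlift f : x y / x + y} -> tlift f 0 = 0.
Proof. by move=> fD; apply: (@addrI _ (tlift f 0)); rewrite -fD !addr0. Qed.

Hypothesis fB : balanced f.

Lemma tlift_pi s : tlift f (\pi_tens s) = \sum_(p <- s) f p.1 p.2.
Proof.
have [fDl fDr fZ] := fB.
have f0 w : f 0 w = 0.
  by apply: (@addrI _ (f 0 w)); rewrite -fDl !addr0.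
rewrite /tlift; set r := repr _.
have : tens_rel r s by apply/tens_eqP; rewrite reprK.
elim: r s / => //=.
- by move=> s t u _ -> _ ->.
- by move=> s s' t t' _ es _ et; rewrite !big_cat /= es et.
- by move=> s t; rewrite !big_cat /= addrC.
- by move=> w; rewrite big_nil big_seq1 f0.
- by move=> v v' w; rewrite !big_cons !big_nil !addr0 fDl.
- by move=> v w w'; rewrite !big_cons !big_nil !addr0 fDr.
- by move=> c v w; rewrite !big_seq1 fZ.
Qed.

Lemma tlift_pure v w : tlift f (tpure v w) = f v w.
Proof. by rewrite tlift_pi big_seq1. Qed.

Lemma tliftD : {morph tlift f : x y / x + y}.
Proof.
move=> x y; elim/tens_piW: x => s; elim/tens_piW: y => t.
by rewrite -[_ + _]/(tadd _ _) tadd_pi !tlift_pi big_cat.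
Qed.

Lemma tlift0 : tlift f 0 = 0.
Proof. exact/tlift_is_additive/tliftD. Qed.

End Lift.

Lemma tlift_scale (Z : lmodType k) (f : V -> W -> Z) (c : k) :
  (forall v v' w, f (v + v') w = f v w + f v' w) ->
  (forall v w w', f v (w + w') = f v w + f v w') ->
  (forall c v w, f (c *: v) w = c *: f v w) ->
  (forall c v w, f v (c *: w) = c *: f v w) ->
  {morph tlift f : x / c *: x}.
Proof.
move=> fDl fDr fZl fZr.
have fB : balanced f by split=> // d v w; rewrite fZl fZr.
elim/tens_ind=> [|v w|x y IHx IHy].
- by rewrite scaler0 (tlift0 fB) scaler0.
- by rewrite -tpureZl !(tlift_pure fB) fZl.
- by rewrite scalerDr !(tliftD fB) IHx IHy scalerDr.
Qed.

End TensorSpace.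

Arguments tens_ind {k V W} P.
Notation "V ⊗ W" := (tens V%type W%type) : type_scope.
Notation "v ⊗ w" := (tpure v w) : ring_scope.

Lemma linear_form_exists (k : fieldType) (V : lmodType k) (v : V) :
  v != 0 -> exists f : V -> k,
    [/\ {morph f : x y / x + y}, forall c, {morph f : x / c *: x >-> c * x} &
        f v = 1].
Proof.
move=> v0.
pose P (A : set V) :=
  (forall c x y, A x -> A y -> A (c *: x + y)) /\ ~ A v.
have [|A [[AL Av] Amax]] := @Zorn_bigcup V P.
  move=> F FP Ft; split; last by case=> X FX; case: (FP X FX).
  move=> c x y [X FX Xx] [Y FY Yy].
  have [XY|YX] := Ft X Y FX FY.
  - by exists Y => //; apply: (FP Y FY).1 => //; exact: XY.
  - by exists X => //; apply: (FP X FX).1 => //; exact: YX.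
have A0 : A 0.
  apply: contrapT => nA0.
  have nA x : ~ A x.
    by move=> Ax; apply: nA0; rewrite -(addNr x) -scaleN1r; exact: AL.
  apply: (Amax [set 0]%classic).
    split; first by move=> x /nA.
    by move=> /(_ 0 erefl) /nA.
  split; last by move=> /= e; rewrite e eqxx in v0.
  by move=> c x y /= -> ->; rewrite scaler0 addr0.
have AD x y : A x -> A y -> A (x + y).
  by move=> Ax Ay; rewrite -[x]scale1r; exact: AL.
have AZ c x : A x -> A (c *: x).
  by move=> Ax; rewrite -[_ *: _]addr0; exact: AL.
have AN x : A x -> A (- x) by move=> Ax; rewrite -scaleN1r; exact: AZ.
have dec u : exists c : k, A (u - c *: v).
  apply: contrapT => nd.
  have nAu : ~ A u by move=> Au; apply: nd; exists 0; rewrite scale0r subr0.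
  apply: (Amax [set x | exists c, A (x - c *: u)]%classic).
    split; first by move=> x Ax; exists 0; rewrite scale0r subr0.
    by move=> /(_ u) sub; apply/nAu/sub; exists 1; rewrite scale1r subrr.
  split.
    move=> c x y [a Ax] [b Ay]; exists (c * a + b).
    rewrite scalerDl -scalerA opprD addrACA -scalerBr; exact: AL.
  case=> c Ac; have c0 : c != 0.
    by apply/eqP => c0; rewrite c0 scale0r subr0 in Ac.
  apply: nd; exists c^-1.
  have -> : u - c^-1 *: v = - c^-1 *: (v - c *: u).
    by rewrite scalerBr scalerA !mulNr mulVf // !scaleNr scale1r opprK addrC.
  exact: AZ.
have uniq u c d : A (u - c *: v) -> A (u - d *: v) -> c = d.
  move=> Ac Ad; apply/eqP; rewrite -subr_eq0; apply/negPn/negP => cd.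
  apply: Av; rewrite -[v]scale1r -(mulVf cd) -scalerA; apply: AZ.
  have -> : (c - d) *: v = (u - d *: v) - (u - c *: v).
    by rewrite opprB [RHS]addrC addrA subrK scalerBl.
  exact/AD/AN.
have /choice [f fP] := dec.
exists f; split.
- move=> x y; apply: (uniq (x + y)) => //.
  by rewrite scalerDl opprD addrACA; exact: AD.
- move=> c x; apply: (uniq (c *: x)) => //.
  by rewrite -scalerA -scalerBr; exact: AZ.
- by apply: (uniq v) => //; rewrite scale1r subrr.
Qed.

Lemma tpure_neq0 (k : fieldType) (V W : algType k) (v : V) (w : W) :
  v != 0 -> w != 0 -> v ⊗ w != 0.
Proof.
move=> /linear_form_exists[f [fD fZ fv]] /linear_form_exists[g [gD gZ gw]].
apply/eqP => vw0; have fgB : balanced (fun x y => f x * g y : k).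
  split=> [x x' y|x y y'|c x y]; first by rewrite fD mulrDl.
  - by rewrite gD mulrDr.
  - by rewrite fZ gZ mulrCA mulrA.
have := tlift_pure fgB v w; rewrite vw0 (tlift0 fgB) fv gw mulr1.
by move/esym/eqP; rewrite oner_eq0.
Qed.

Section TensorAlgebra.
Variables (k : fieldType) (A B : algType k).
Local Notation T := (A ⊗ B)%type.

Definition tmul (x y : T) : T :=
  tlift (fun a b => tlift (fun a' b' => (a * a') ⊗ (b * b')) y) x.

Fact tmul_balanced_in a b :
  balanced (fun (a' : A) (b' : B) => (a * a') ⊗ (b * b') : T).
Proof.
split=> [v v' w|v w w'|c v w]; first by rewrite mulrDr tpureDl.
- by rewrite mulrDr tpureDr.
- by rewrite -!scalerAr tpureZl tpureZr.
Qed.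

Fact tmul_balanced_out y : balanced (fun (a : A) (b : B) =>
  tlift (fun a' b' => (a * a') ⊗ (b * b')) y : T).
Proof.
have H := tmul_balanced_in.
split=> [v v' w|v w w'|c v w]; elim/(@tens_ind _ A B): y => [|a b|x y IHx IHy];
  rewrite ?(tlift0 (H _ _)) ?addr0 ?(tlift_pure (H _ _)) ?(tliftD (H _ _)) //.
- by rewrite mulrDl tpureDl.
- by rewrite IHx IHy addrACA.
- by rewrite mulrDl tpureDr.
- by rewrite IHx IHy addrACA.
- by rewrite -!scalerAl tpureZl tpureZr.
- by rewrite IHx IHy.
Qed.

Lemma tmul_pure a b a' b' :
  tmul (a ⊗ b) (a' ⊗ b') = (a * a') ⊗ (b * b').
Proof.
by rewrite /tmul (tlift_pure (tmul_balanced_out _))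
  (tlift_pure (tmul_balanced_in _ _)).
Qed.

Lemma tmulDl : left_distributive tmul +%R.
Proof. by move=> x y z; exact: tliftD (tmul_balanced_out _) _ _. Qed.

Lemma tmul0l y : tmul 0 y = 0.
Proof. exact: tlift0 (tmul_balanced_out _). Qed.

Lemma tmul_purer a b y :
  tmul (a ⊗ b) y = tlift (fun a' b' => (a * a') ⊗ (b * b')) y.
Proof. by rewrite /tmul (tlift_pure (tmul_balanced_out _)). Qed.

Lemma tmulDr : right_distributive tmul +%R.
Proof.
move=> x y z; elim/(@tens_ind _ A B): x => [|a b|x x' IHx IHx'].
- by rewrite !tmul0l addr0.
- by rewrite !tmul_purer (tliftD (tmul_balanced_in _ _)).
- by rewrite !tmulDl IHx IHx' addrACA.
Qed.

Lemma tmul0r x : tmul x 0 = 0.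
Proof. by apply: (@addrI _ (tmul x 0)); rewrite -tmulDr !addr0. Qed.

Lemma tmulA : associative tmul.
Proof.
move=> x y z; elim/(@tens_ind _ A B): x => [|a b|x x' IH IH'].
- by rewrite !tmul0l.
- elim/(@tens_ind _ A B): y => [|a' b'|y y' IH IH'].
  + by rewrite !tmul0l tmul0r tmul0l.
  + elim/(@tens_ind _ A B): z => [|a'' b''|z z' IH IH'].
    * by rewrite !tmul0r.
    * by rewrite !tmul_pure !mulrA.
    * by rewrite !tmulDr IH IH'.
  + by rewrite !(tmulDl, tmulDr) IH IH'.
- by rewrite !tmulDl IH IH'.
Qed.

Lemma tmul1l : left_id (1 ⊗ 1) tmul.
Proof.
move=> x; elim/(@tens_ind _ A B): x => [|a b|x x' IH IH'].
- by rewrite tmul0r.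
- by rewrite tmul_pure !mul1r.
- by rewrite tmulDr IH IH'.
Qed.

Lemma tmul1r : right_id (1 ⊗ 1) tmul.
Proof.
move=> x; elim/(@tens_ind _ A B): x => [|a b|x x' IH IH'].
- by rewrite tmul0l.
- by rewrite tmul_pure !mulr1.
- by rewrite tmulDl IH IH'.
Qed.

Lemma tone_neq0 : (1 : A) ⊗ (1 : B) != 0.
Proof. by apply: tpure_neq0; exact: oner_neq0. Qed.

HB.instance Definition _ := GRing.Zmodule_isNzRing.Build T
  tmulA tmul1l tmul1r tmulDl tmulDr tone_neq0.

Lemma tpure1 : (1 : A) ⊗ (1 : B) = 1.
Proof. by []. Qed.

Lemma tpureM (a a' : A) (b b' : B) :
  (a ⊗ b) * (a' ⊗ b') = (a * a') ⊗ (b * b').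
Proof. exact: tmul_pure. Qed.

Lemma tscaleAl (c : k) (x y : T) : c *: (x * y) = (c *: x) * y.
Proof.
elim/(@tens_ind _ A B): x => [|a b|x x' IH IH']; first by rewrite scaler0 !mul0r scaler0.
- elim/(@tens_ind _ A B): y => [|a' b'|y y' IH IH']; first by rewrite !mulr0 scaler0.
  + by rewrite -tpureZl !tpureM -scalerAl tpureZl.
  + by rewrite !mulrDr scalerDr IH IH'.
- by rewrite !(mulrDl, scalerDr) IH IH'.
Qed.

HB.instance Definition _ := GRing.Lmodule_isLalgebra.Build k T tscaleAl.

Lemma tscaleAr (c : k) (x y : T) : c *: (x * y) = x * (c *: y).
Proof.
elim/(@tens_ind _ A B): x => [|a b|x x' IH IH']; first by rewrite !mul0r scaler0.
- elim/(@tens_ind _ A B): y => [|a' b'|y y' IH IH'].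
  + by rewrite scaler0 !mulr0 scaler0.
  + by rewrite -tpureZr !tpureM -scalerAr tpureZr.
  + by rewrite !(mulrDr, scalerDr) IH IH'.
- by rewrite !mulrDl scalerDr IH IH'.
Qed.

HB.instance Definition _ := GRing.Lalgebra_isAlgebra.Build k T tscaleAr.

(* The units of A ⊗ B are the two-sided invertible elements.                  *)
Definition tinvertible (x : T) : bool :=
  `[< exists y, y * x = 1 /\ x * y = 1 >].

Definition tinv (x : T) : T :=
  if pselect (exists y, y * x = 1 /\ x * y = 1) is left e
  then projT1 (cid e) else x.

Fact tmulVr : {in tinvertible, left_inverse 1 tinv *%R}.
Proof.
move=> x /asboolP e; rewrite /tinv; case: pselect => // e'.
by case: (cid e') => y [].
Qed.

Fact tdivrr : {in tinvertible, right_inverse 1 tinv *%R}.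
Proof.
move=> x /asboolP e; rewrite /tinv; case: pselect => // e'.
by case: (cid e') => y [].
Qed.

Fact tunitP (x y : T) : y * x = 1 /\ x * y = 1 -> tinvertible x.
Proof. by move=> xy; apply/asboolP; exists y. Qed.

Fact tinv_out : {in [predC tinvertible], tinv =1 id}.
Proof.
by move=> x /asboolP nx; rewrite /tinv; case: pselect.
Qed.

HB.instance Definition _ := GRing.NzRing_hasMulInverse.Build T
  tmulVr tdivrr tunitP tinv_out.

End TensorAlgebra.

Definition tmap (k : fieldType) (V V' W W' : algType k)
    (f : V -> V') (g : W -> W') : V ⊗ W -> V' ⊗ W' :=
  tlift (fun v w => f v ⊗ g w).

Definition tflip (k : fieldType) (V W : algType k) : V ⊗ W -> W ⊗ V :=
  tlift (fun v w => w ⊗ v).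

Definition tassoc (k : fieldType) (U V W : algType k) :
    U ⊗ (V ⊗ W) -> U ⊗ V ⊗ W :=
  tlift (fun u => tlift (fun v w => u ⊗ v ⊗ w)).

Section TensorMaps.
Variables (k : fieldType) (U V W V' W' : algType k).

Lemma tmap_pure (f : {linear V -> V'}) (g : {linear W -> W'}) v w :
  tmap f g (v ⊗ w) = f v ⊗ g w.
Proof.
apply: tlift_pure; split=> [v1 v2 w1|v1 w1 w2|c v1 w1].
- by rewrite linearD tpureDl.
- by rewrite linearD tpureDr.
- by rewrite !linearZ tpureZl tpureZr.
Qed.

Lemma tflip_pure (v : V) (w : W) : tflip (v ⊗ w) = w ⊗ v.
Proof.
apply: tlift_pure; split=> [v1 v2 w1|v1 w1 w2|c v1 w1].
- by rewrite tpureDr.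
- by rewrite tpureDl.
- by rewrite tpureZl tpureZr.
Qed.

Fact tassoc_balanced_in (u : U) :
  balanced (fun (v : V) (w : W) => u ⊗ v ⊗ w).
Proof.
split=> [v1 v2 w1|v1 w1 w2|c v1 w1].
- by rewrite tpureDr tpureDl.
- by rewrite tpureDr.
- by rewrite tpureZr tpureZl tpureZr.
Qed.

Fact tassoc_balanced_out :
  balanced (fun (u : U) => tlift (fun (v : V) (w : W) => u ⊗ v ⊗ w)).
Proof.
have H := tassoc_balanced_in.
split=> [u1 u2 x|u x y|c u x]; last 2 first.
- exact: (tliftD (H u)).
- elim/(@tens_ind _ V W): x => [|v w|x y IHx IHy].
  + by rewrite scaler0 (tlift0 (H _)) (tlift0 (H _)).
  + by rewrite -tpureZl !(tlift_pure (H _)) tpureZl tpureZr.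
  + by rewrite scalerDr !(tliftD (H _)) IHx IHy.
elim/(@tens_ind _ V W): x => [|v w|x y IHx IHy].
- by rewrite !(tlift0 (H _)) addr0.
- by rewrite !(tlift_pure (H _)) !tpureDl.
- by rewrite !(tliftD (H _)) IHx IHy addrACA.
Qed.

Lemma tassoc_pure (u : U) (v : V) (w : W) :
  tassoc (u ⊗ (v ⊗ w)) = u ⊗ v ⊗ w.
Proof.
by rewrite /tassoc (tlift_pure tassoc_balanced_out)
  (tlift_pure (tassoc_balanced_in u)).
Qed.

End TensorMaps.

Section QuasiBialgebra.
Variables (k : fieldType) (A : unitAlgType k).
Local Notation A2 := (A ⊗ A)%type.
Local Notation A3 := (A ⊗ A ⊗ A)%type.
Local Notation A4 := (A ⊗ A ⊗ A ⊗ A)%type.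

Implicit Types (D : A -> A2) (e : A -> k) (P : A3) (R F : A2).

(* D, e, P, R stand for Δ, ε, Φ and the R-matrix. Tensor powers are bracketed *)
(* to the left, so maps and elements landing elsewhere are reassociated.      *)

Definition id_D D : A2 -> A3 := fun x => tassoc (tmap id D x).
Definition D_id D : A2 -> A3 := tmap D id.

Definition id_id_D D : A3 -> A4 := fun x => tassoc (tmap id D x).
Definition id_D_id D : A3 -> A4 := tmap (id_D D) id.
Definition D_id_id D : A3 -> A4 := tmap (D_id D) id.

(* ε ⊗ id and id ⊗ ε, with k ⊗ V and V ⊗ k identified with V.                 *)
Definition e_id (V : algType k) e : A ⊗ V -> V :=
  tlift (fun a v => e a *: v).
Definition id_e (V : algType k) e : V ⊗ A -> V :=
  tlift (fun v a => e a *: v).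

Definition id_e_id e : A3 -> A2 := tmap (id_e e) id.
Definition e_e_id e : A3 -> A := fun x => e_id e (tmap (e_id e) id x).
Definition id_e_e e : A3 -> A := fun x => id_e e (id_e e x).

Definition one_tens2 (x : A2) : A3 := tassoc (1 ⊗ x).
Definition one_tens3 (x : A3) : A4 := tmap (@tassoc k A A A) id (tassoc (1 ⊗ x)).

(* slot i a has a in position i (1, 2 or 3) and 1 in the other positions; the *)
(* catch-all case is position 3.                                              *)
Definition slot (i : nat) (a : A) : A3 :=
  match i with
  | 1 => a ⊗ 1 ⊗ 1
  | 2 => 1 ⊗ a ⊗ 1
  | _ => 1 ⊗ 1 ⊗ a
  end.

(* x_{ij} and x_{ijl}: the first leg goes to slot i, the second to slot j,    *)
(* the third to slot l (see leg2_pure and leg3_pure).                         *)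
Definition leg2 (i j : nat) (x : A2) : A3 :=
  tlift (fun a b => slot i a * slot j b) x.

Definition leg3 (i j l : nat) (x : A3) : A3 :=
  tlift (fun ab c => leg2 i j ab * slot l c) x.

Fact slot_linear i : linear (slot i).
Proof.
case: i => [|[|[|i]]] c a b /=;
  by rewrite ?(tpureDl, tpureDr, tpureZl, tpureZr).
Qed.

HB.instance Definition _ i := GRing.isLinear.Build k A A3 _ (slot i)
  (slot_linear i).

Fact leg2_balanced i j : balanced (fun a b => slot i a * slot j b).
Proof.
split=> [v v' w|v w w'|c v w]; first by rewrite linearD mulrDl.
- by rewrite linearD mulrDr.
- by rewrite !linearZ /= -scalerAl scalerAr.
Qed.

Fact leg3_balanced i j l : balanced (fun ab c => leg2 i j ab * slot l c).
Proof.
have H := leg2_balanced i j.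
split=> [v v' w|v w w'|c v w]; first by rewrite /leg2 (tliftD H) mulrDl.
- by rewrite linearD mulrDr.
- rewrite linearZ /= -scalerAr scalerAl; congr (_ * _).
  apply: tlift_scale => [a a' b|a b b'|d a b|d a b].
  + by rewrite linearD mulrDl.
  + by rewrite linearD mulrDr.
  + by rewrite linearZ /= scalerAl.
  + by rewrite linearZ /= scalerAr.
Qed.

Lemma leg2_pure i j a b : leg2 i j (a ⊗ b) = slot i a * slot j b.
Proof. exact: (tlift_pure (leg2_balanced i j)). Qed.

Lemma leg3_pure i j l a b c :
  leg3 i j l (a ⊗ b ⊗ c) = slot i a * slot j b * slot l c.
Proof. by rewrite /leg3 (tlift_pure (leg3_balanced i j l)) leg2_pure. Qed.

Record is_quasi_bialgebra_with D e P (cr cl : A) : Prop := {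
  qb_D_linear : linear D;
  qb_D_mult : monoid_morphism D;
  qb_e_linear : scalar e;
  qb_e_mult : monoid_morphism e;
  qb_P_unit : P \is a GRing.unit;
  qb_cr_unit : cr \is a GRing.unit;
  qb_cl_unit : cl \is a GRing.unit;
  qb_coassoc : forall a, id_D D (D a) = P * D_id D (D a) * P^-1;
  qb_pentagon :
    id_id_D D P * D_id_id D P = one_tens3 P * id_D_id D P * (P ⊗ 1);
  qb_counitl : forall a, e_id e (D a) = cl^-1 * a * cl;
  qb_counitr : forall a, id_e e (D a) = cr^-1 * a * cr;
  qb_triangle : id_e_id e P = cr ⊗ cl^-1
}.

(* The normalized unit constraints, as determined by Φ.                       *)
Definition cl_of e P : A := (e_e_id e P)^-1.
Definition cr_of e P : A := id_e_e e P.

Record is_quasi_bialgebra D e P : Prop := {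
  qb_axioms : is_quasi_bialgebra_with D e P (cr_of e P) (cl_of e P);
  qb_cr_norm : e (cr_of e P) = 1;
  qb_cl_norm : e (cl_of e P) = 1
}.

Record is_quasi_triangular D e P R : Prop := {
  qt_quasi_bialgebra : is_quasi_bialgebra D e P;
  qt_R_unit : R \is a GRing.unit;
  qt_D_op : forall a, tflip (D a) * R = R * D a;
  qt_id_D : id_D D R =
    (leg3 2 3 1 P)^-1 * leg2 1 3 R * leg3 2 1 3 P * leg2 1 2 R
      * (leg3 1 2 3 P)^-1;
  qt_D_id : D_id D R =
    leg3 3 1 2 P * leg2 1 3 R * (leg3 1 3 2 P)^-1 * leg2 2 3 R
      * leg3 1 2 3 P
}.

End QuasiBialgebra.

(* Main.v *)
(** Put [G = F_12 (Δ ⊗ id)F] and [H = F_23 (id ⊗ Δ)F], so that [Φ_F G = H Φ].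
    Conjugation by the product of copies of [F] attached to a bracketing carries
    each axiom to the twisted one. For the hexagons, [R_F] intertwines the
    permuted copies of [G] and of [H] as [R] does, because [Δ^op R = R Δ]. With
    [u = (ε ⊗ id)F], [v = (id ⊗ ε)F] and [w = ε(u) = ε(v)], the normalized
    unit constraints of the twist are [w c_r v^-1] and [w c_l u^-1]. *)

Require Import Defs.
From HB Require Import structures.
From mathcomp Require Import all_boot all_order all_algebra.
Import GRing.Theory.
Set Implicit Arguments.
Unset Strict Implicit.
Unset Printing Implicit Defensive.
Local Open Scope ring_scope.

(** * Structural maps between tensor products as algebra morphisms *)

Section TensorMorphisms.
Variable k : fieldType.

Lemma tlift_linear (V W : algType k) (Z : lmodType k) (f : V -> W -> Z) :
  (forall w, linear (f^~ w)) -> (forall v, linear (f v)) -> linear (tlift f).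
Proof.
move=> fl fr.
have fDl v v' w : f (v + v') w = f v w + f v' w.
  by have := fl w 1 v v'; rewrite !scale1r.
have fDr v w w' : f v (w + w') = f v w + f v w'.
  by have := fr v 1 w w'; rewrite !scale1r.
have f0l w : f 0 w = 0 by apply: (@addrI _ (f 0 w)); rewrite -fDl !addr0.
have f0r v : f v 0 = 0 by apply: (@addrI _ (f v 0)); rewrite -fDr !addr0.
have fZl c v w : f (c *: v) w = c *: f v w.
  by have := fl w c v 0; rewrite f0l !addr0.
have fZr c v w : f v (c *: w) = c *: f v w.
  by have := fr v c w 0; rewrite f0r !addr0.
have fB : balanced f by split=> // c v w; rewrite fZl fZr.
by move=> c x y; rewrite (tliftD fB) (tlift_scale c fDl fDr fZl fZr).
Qed.

Section Pure.
Variables V W : algType k.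

Fact tpure_linear (v : V) : linear (@tpure k V W v).
Proof. by move=> c w w'; rewrite tpureDr tpureZr. Qed.
HB.instance Definition _ (v : V) :=
  GRing.isLinear.Build k W (V ⊗ W)%type _ (@tpure k V W v) (tpure_linear v).

(** Pure tensors span, so bilinearity of the product reduces multiplicativity to them. *)
Lemma tens_monoid_morphism (Z : algType k) (f : {linear (V ⊗ W)%type -> Z}) :
  f 1 = 1 ->
  (forall v w v' w', f ((v * v') ⊗ (w * w')) = f (v ⊗ w) * f (v' ⊗ w')) ->
  monoid_morphism f.
Proof.
move=> f1 fM; split=> // x y.
elim/(@tens_ind _ V W): x => [|v w|x x' IH IH'];
  first by rewrite mul0r linear0 mul0r.
- elim/(@tens_ind _ V W): y => [|v' w'|y y' IH IH'];
    first by rewrite mulr0 linear0 mulr0.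
  + by rewrite tpureM fM.
  + by rewrite mulrDr linearD IH IH' linearD mulrDr.
- by rewrite mulrDl linearD IH IH' linearD mulrDl.
Qed.

End Pure.

Section Map.
Variables V V' W W' : algType k.

Fact tmap_linear (f : {linear V -> V'}) (g : {linear W -> W'}) :
  linear (tmap f g).
Proof.
apply: tlift_linear => [w|v] c x y; first by rewrite linearP tpureDl tpureZl.
by rewrite linearP tpureDr tpureZr.
Qed.
HB.instance Definition _ (f : {linear V -> V'}) (g : {linear W -> W'}) :=
  GRing.isLinear.Build k (V ⊗ W)%type (V' ⊗ W')%type _ (tmap f g)
    (tmap_linear f g).

Fact tmap_monoid_morphism (f : {lrmorphism V -> V'})
    (g : {lrmorphism W -> W'}) :
  monoid_morphism (tmap f g).
Proof.
apply: tens_monoid_morphism => [|v w v' w'] /=.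
  by rewrite -tpure1 tmap_pure !rmorph1.
by rewrite !tmap_pure !rmorphM tpureM.
Qed.
HB.instance Definition _ (f : {lrmorphism V -> V'})
    (g : {lrmorphism W -> W'}) :=
  GRing.isMonoidMorphism.Build (V ⊗ W)%type (V' ⊗ W')%type (tmap f g)
    (tmap_monoid_morphism f g).

Fact tflip_linear : linear (@tflip k V W).
Proof.
apply: tlift_linear => [w|v] c x y; first by rewrite tpureDr tpureZr.
by rewrite tpureDl tpureZl.
Qed.
HB.instance Definition _ :=
  GRing.isLinear.Build k (V ⊗ W)%type (W ⊗ V)%type _ (@tflip k V W)
    tflip_linear.

Fact tflip_monoid_morphism : monoid_morphism (@tflip k V W).
Proof.
apply: tens_monoid_morphism => [|v w v' w'] /=.
  by rewrite -tpure1 tflip_pure.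
by rewrite !tflip_pure tpureM.
Qed.
HB.instance Definition _ :=
  GRing.isMonoidMorphism.Build (V ⊗ W)%type (W ⊗ V)%type (@tflip k V W)
    tflip_monoid_morphism.
End Map.

Section Assoc.
Variables U V W : algType k.

Fact tassoc_linear : linear (@tassoc k U V W).
Proof.
apply: tlift_linear => [t|u].
  have H u := @tassoc_balanced_in k U V W u.
  move=> c x y; elim/(@tens_ind _ V W): t => [|v w|s t IHs IHt].
  - by rewrite !(tlift0 (H _)) scaler0 addr0.
  - by rewrite !(tlift_pure (H _)) !(tpureDl, tpureZl).
  - by rewrite !(tliftD (H _)) IHs IHt scalerDr addrACA.
apply: tlift_linear => [w|v] c x y.
  by rewrite tpureDr tpureDl tpureZr tpureZl.
by rewrite tpureDr tpureZr.
Qed.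
HB.instance Definition _ :=
  GRing.isLinear.Build k (U ⊗ (V ⊗ W))%type (U ⊗ V ⊗ W)%type _
    (@tassoc k U V W) tassoc_linear.

Fact tassoc_monoid_morphism : monoid_morphism (@tassoc k U V W).
Proof.
apply: tens_monoid_morphism => [|u x u' y] /=.
  by rewrite -tpure1 tassoc_pure.
elim/(@tens_ind _ V W): x => [|v w|x x' IH IH'].
- by rewrite mul0r !linear0 mul0r.
- elim/(@tens_ind _ V W): y => [|v' w'|y y' IH IH'].
  + by rewrite mulr0 !linear0 mulr0.
  + by rewrite tpureM !tassoc_pure !tpureM.
  + by rewrite mulrDr !linearD /= IH IH' mulrDr.
- by rewrite mulrDl !linearD /= IH IH' mulrDl.
Qed.
HB.instance Definition _ :=
  GRing.isMonoidMorphism.Build (U ⊗ (V ⊗ W))%type (U ⊗ V ⊗ W)%type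
    (@tassoc k U V W) tassoc_monoid_morphism.
End Assoc.

End TensorMorphisms.

(** * Adjoining a unit leg, and images of units *)

Section Embeddings.
Variables (k : fieldType) (V W : algType k).

Lemma tpure1_monoid_morphism :
  monoid_morphism (fun v : V => v ⊗ (1 : W)).
Proof. by split=> // x y; rewrite tpureM mulr1. Qed.

Lemma pure1t_monoid_morphism :
  monoid_morphism (@tpure k V W 1).
Proof. by split=> // x y; rewrite tpureM mulr1. Qed.
HB.instance Definition _ :=
  GRing.isMonoidMorphism.Build W (V ⊗ W)%type (@tpure k V W 1)
    pure1t_monoid_morphism.
End Embeddings.

(** Takes a bare function with a proof of multiplicativity, because [leg2] and [leg3] are shown
    multiplicative only under conditions on their indices and so carry no bundled morphism
    structure. *)
Lemma monoid_morphism_unit (R S : unitRingType) (f : R -> S) x :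
  monoid_morphism f -> x \is a GRing.unit ->
  f x \is a GRing.unit /\ f x^-1 = (f x)^-1.
Proof.
move=> [f1 fM] ux.
have e1 : f x^-1 * f x = 1 by rewrite -fM mulVr.
have e2 : f x * f x^-1 = 1 by rewrite -fM mulrV.
have u : f x \is a GRing.unit by apply/unitrP; exists (f x^-1).
by split=> //; apply: (mulIr u); rewrite e1 mulVr.
Qed.

(** * Coproducts on the legs of threefold and fourfold tensors *)

Section Coproduct.
Variables (k : fieldType) (A : unitAlgType k).
Variable D : {lrmorphism A -> (A ⊗ A)%type}.
Local Notation A2 := (A ⊗ A)%type.
Local Notation A3 := (A ⊗ A ⊗ A)%type.
Local Notation A4 := (A ⊗ A ⊗ A ⊗ A)%type.
(** The identity as a bundled morphism, so that [tmap] inherits its morphism structure when one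
    factor is the identity. *)
Let I : {lrmorphism A -> A} := idfun.
Let I2 : {lrmorphism A2 -> A2} := idfun.

Lemma D_id_pure a b : D_id D (a ⊗ b) = D a ⊗ b.
Proof. exact: (tmap_pure D I). Qed.
Lemma id_D_pure a b : id_D D (a ⊗ b) = tassoc (a ⊗ D b).
Proof. by rewrite /id_D -(tmap_pure I D). Qed.

HB.instance Definition _ :=
  GRing.LRMorphism.copy (D_id D) (tmap D I).
HB.instance Definition _ :=
  GRing.LRMorphism.copy (id_D D) (@tassoc k A A A \o tmap I D).
HB.instance Definition _ :=
  GRing.LRMorphism.copy (@one_tens2 k A) (@tassoc k A A A \o tpure 1).
HB.instance Definition _ :=
  GRing.LRMorphism.copy (@one_tens3 k A)
    (tmap (@tassoc k A A A) I \o (@tassoc k A A2 A \o tpure 1)).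
HB.instance Definition _ :=
  GRing.LRMorphism.copy (id_id_D D) (@tassoc k A2 A A \o tmap I2 D).
HB.instance Definition _ :=
  GRing.LRMorphism.copy (id_D_id D) (tmap (id_D D) I).
HB.instance Definition _ :=
  GRing.LRMorphism.copy (D_id_id D) (tmap (D_id D) I).

Lemma D_id_id_pure x b : D_id_id D (x ⊗ b) = D_id D x ⊗ b.
Proof. exact: (tmap_pure (D_id D) I). Qed.
Lemma id_D_id_pure x b : id_D_id D (x ⊗ b) = id_D D x ⊗ b.
Proof. exact: (tmap_pure (id_D D) I). Qed.
Lemma id_id_D_pure x b : id_id_D D (x ⊗ b) = tassoc (x ⊗ D b).
Proof. by rewrite /id_id_D -(tmap_pure I2 D). Qed.

Lemma id_id_D_tens1 x : id_id_D D (x ⊗ 1) = x ⊗ 1 ⊗ 1.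
Proof. by rewrite id_id_D_pure rmorph1 -tpure1 tassoc_pure. Qed.

(** This is [a ⊗ x] rebracketed to the left. It extends [one_tens3] to an arbitrary first leg, as
    inductions over pure tensors require. *)
Definition assoc3 (a : A) : {linear A3 -> A4} :=
  tmap (@tassoc k A A A) I \o (@tassoc k A A2 A \o tpure a).

Lemma assoc3_1 x : assoc3 1 x = one_tens3 x.
Proof. by []. Qed.

Lemma assoc3_pure a x b : assoc3 a (x ⊗ b) = tassoc (a ⊗ x) ⊗ b.
Proof. by rewrite /assoc3 /= tassoc_pure (tmap_pure (@tassoc k A A A) I). Qed.

Lemma assoc3M a a' x y : assoc3 (a * a') (x * y) = assoc3 a x * assoc3 a' y.
Proof. by rewrite /assoc3 /= -!rmorphM /= tpureM. Qed.

Lemma tassoc_id_D a x : id_id_D D (tassoc (a ⊗ x)) = assoc3 a (id_D D x).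
Proof.
elim/(@tens_ind k A A): x => [|b c|x y IHx IHy]; first by rewrite !linear0.
  rewrite tassoc_pure id_id_D_pure id_D_pure.
  (* [tassoc] computes only on pure tensors, so [D c] has to be decomposed as well. *)
  elim/(@tens_ind k A A): (D c) => [|d d'|x y IHx IHy].
    by rewrite !linear0.
    by rewrite !tassoc_pure assoc3_pure tassoc_pure.
  by rewrite !linearD /= IHx IHy.
by rewrite !linearD /= IHx IHy.
Qed.

Lemma tassoc_D_id a x : id_D_id D (tassoc (a ⊗ x)) = assoc3 a (D_id D x).
Proof.
elim/(@tens_ind k A A): x => [|b c|x y IHx IHy]; first by rewrite !linear0.
  by rewrite tassoc_pure id_D_id_pure D_id_pure assoc3_pure id_D_pure.
by rewrite !linearD /= IHx IHy.
Qed.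

Lemma tassoc_D_id_id a x : D_id_id D (tassoc (a ⊗ x)) = tassoc (D a ⊗ x).
Proof.
elim/(@tens_ind k A A): x => [|b c|x y IHx IHy]; first by rewrite !linear0.
  by rewrite !tassoc_pure D_id_id_pure D_id_pure.
by rewrite !linearD /= IHx IHy.
Qed.

Lemma D_id_id_one_tens2 x : D_id_id D (one_tens2 x) = one_tens3 (one_tens2 x).
Proof.
rewrite /one_tens2 tassoc_D_id_id rmorph1 -assoc3_1.
elim/(@tens_ind k A A): x => [|b c|x y IHx IHy]; first by rewrite !linear0.
  by rewrite !tassoc_pure assoc3_pure tassoc_pure.
by rewrite !linearD /= IHx IHy.
Qed.

Lemma one_tens3_tens1 (x : A2) : one_tens3 (x ⊗ 1) = one_tens2 x ⊗ 1.
Proof. by rewrite -assoc3_1 assoc3_pure. Qed.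

(** The two factors occupy disjoint legs, 1, 2 and 3, 4. *)
Lemma tens12_34_comm (x y : A2) :
  (x ⊗ 1 ⊗ 1) * one_tens3 (one_tens2 y) =
  one_tens3 (one_tens2 y) * (x ⊗ 1 ⊗ 1).
Proof.
elim/(@tens_ind k A A): y => [|b c|y z IHy IHz].
- by rewrite !linear0 mulr0 mul0r.
- rewrite /one_tens2 tassoc_pure -assoc3_1 assoc3_pure tassoc_pure !tpureM.
  by rewrite tpure1 !mul1r !mulr1.
- by rewrite !linearD /= mulrDr mulrDl IHy IHz.
Qed.

(** Both sides are (Δ ⊗ Δ)x. *)
Lemma id_id_D_D_id x : id_id_D D (D_id D x) = D_id_id D (id_D D x).
Proof.
elim/(@tens_ind k A A): x => [|b c|x y IHx IHy]; first by rewrite !linear0.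
  by rewrite D_id_pure id_D_pure id_id_D_pure tassoc_D_id_id.
by rewrite !linearD /= IHx IHy.
Qed.

Lemma one_tens3_id_D x : one_tens3 (id_D D x) = id_id_D D (one_tens2 x).
Proof. by rewrite /one_tens2 tassoc_id_D. Qed.

Lemma one_tens3_D_id x : one_tens3 (D_id D x) = id_D_id D (one_tens2 x).
Proof. by rewrite /one_tens2 tassoc_D_id. Qed.

Section Coassociator.
Variable P : A3.
Hypothesis coassoc : forall a, id_D D (D a) * P = P * D_id D (D a).

(** Quasi-coassociativity is applied to the second leg of [x]; the first leg meets only the unit in
    [1 ⊗ Φ]. *)
Lemma coassoc_id_D x :
  id_id_D D (id_D D x) * one_tens3 P = one_tens3 P * id_D_id D (id_D D x).
Proof.
elim/(@tens_ind k A A): x => [|a b|x y IHx IHy].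
- by rewrite !linear0 mul0r mulr0.
- rewrite id_D_pure tassoc_id_D tassoc_D_id -assoc3_1 -!assoc3M coassoc.
  by rewrite mulr1 mul1r.
- by rewrite !linearD /= mulrDl mulrDr IHx IHy.
Qed.

Lemma coassoc_D_id x :
  id_D_id D (D_id D x) * (P ⊗ 1) = (P ⊗ 1) * D_id_id D (D_id D x).
Proof.
elim/(@tens_ind k A A): x => [|a b|x y IHx IHy].
- by rewrite !linear0 mul0r mulr0.
- by rewrite D_id_pure id_D_id_pure D_id_id_pure !tpureM coassoc mulr1 mul1r.
- by rewrite !linearD /= mulrDl mulrDr IHx IHy.
Qed.
End Coassociator.

End Coproduct.

(** * Moving [F] past the two coproducts that it intertwines *)

Section Conjugation.
Variables (k : fieldType) (A : unitAlgType k).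
Variables (D E : {lrmorphism A -> (A ⊗ A)%type}) (F : A ⊗ A).
Hypothesis DE : forall a, E a * F = F * D a.

Lemma D_id_conj x : D_id E x * (F ⊗ 1) = (F ⊗ 1) * D_id D x.
Proof.
elim/(@tens_ind k A A): x => [|a b|x y IHx IHy].
- by rewrite !linear0 mul0r mulr0.
- by rewrite !D_id_pure !tpureM DE mulr1 mul1r.
- by rewrite !linearD /= mulrDl mulrDr IHx IHy.
Qed.

Lemma tassoc_conj (U : algType k) (u : U) b :
  tassoc (u ⊗ E b) * tassoc (1 ⊗ F) = tassoc (1 ⊗ F) * tassoc (u ⊗ D b).
Proof. by rewrite -!rmorphM /= !tpureM DE mulr1 mul1r. Qed.

Lemma id_D_conj x : id_D E x * one_tens2 F = one_tens2 F * id_D D x.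
Proof.
elim/(@tens_ind k A A): x => [|a b|x y IHx IHy].
- by rewrite !linear0 mul0r mulr0.
- by rewrite !id_D_pure tassoc_conj.
- by rewrite !linearD /= mulrDl mulrDr IHx IHy.
Qed.

Lemma D_id_id_conj x :
  D_id_id E x * (F ⊗ 1 ⊗ 1) = (F ⊗ 1 ⊗ 1) * D_id_id D x.
Proof.
elim/(@tens_ind k (A ⊗ A)%type A): x => [|a b|x y IHx IHy].
- by rewrite !linear0 mul0r mulr0.
- by rewrite !D_id_id_pure !tpureM D_id_conj mulr1 mul1r.
- by rewrite !linearD /= mulrDl mulrDr IHx IHy.
Qed.

Lemma id_D_id_conj x :
  id_D_id E x * (one_tens2 F ⊗ 1) = (one_tens2 F ⊗ 1) * id_D_id D x.
Proof.
elim/(@tens_ind k (A ⊗ A)%type A): x => [|a b|x y IHx IHy].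
- by rewrite !linear0 mul0r mulr0.
- by rewrite !id_D_id_pure !tpureM id_D_conj mulr1 mul1r.
- by rewrite !linearD /= mulrDl mulrDr IHx IHy.
Qed.

(** On the right, [1] is the unit of [A ⊗ A]. Both sides equal (Δ ⊗ id ⊗ id)(1 ⊗ x), since Δ(1) =
    1. *)
Lemma one_tens3_one_tens2 (x : A ⊗ A) :
  one_tens3 (one_tens2 x) = tassoc (1 ⊗ x).
Proof. by rewrite -(D_id_id_one_tens2 D) /one_tens2 tassoc_D_id_id rmorph1. Qed.

Lemma id_id_D_conj x :
  id_id_D E x * one_tens3 (one_tens2 F) = one_tens3 (one_tens2 F) * id_id_D D x.
Proof.
rewrite one_tens3_one_tens2.
elim/(@tens_ind k (A ⊗ A)%type A): x => [|a b|x y IHx IHy].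
- by rewrite !linear0 mul0r mulr0.
- by rewrite !id_id_D_pure tassoc_conj.
- by rewrite !linearD /= mulrDl mulrDr IHx IHy.
Qed.
End Conjugation.

(** * Index notation: placing tensors in permuted slots *)

Section Legs.
Variables (k : fieldType) (A : unitAlgType k).
Local Notation A2 := (A ⊗ A)%type.
Local Notation A3 := (A ⊗ A ⊗ A)%type.

(* Indices outside 1, 2, 3 are excluded as [slot] reads them all as 3. *)
Definition slots (i j : nat) : bool := [&& 0 < i < 4, 0 < j < 4 & i != j]%N.

Lemma slots_sym i j : slots i j = slots j i.
Proof. by rewrite /slots andbCA eq_sym. Qed.

Lemma slotC i j (a b : A) :
  slots i j -> slot i a * slot j b = slot j b * slot i a.
Proof.
by case: i => [|[|[|[|i]]]] //; case: j => [|[|[|[|j]]]] // _;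
  rewrite /= !tpureM !mulr1 !mul1r.
Qed.

Lemma slot1 i : slot i (1 : A) = 1.
Proof. by case: i => [|[|[|[|i]]]]. Qed.

Lemma slotM i (a b : A) : slot i (a * b) = slot i a * slot i b.
Proof. by case: i => [|[|[|[|i]]]]; rewrite /= !tpureM !mulr1. Qed.

Fact leg2_linear i j : linear (@leg2 k A i j).
Proof.
apply: tlift_linear => [b|a] c x y; first by rewrite linearP mulrDl scalerAl.
by rewrite linearP mulrDr scalerAr.
Qed.
HB.instance Definition _ i j :=
  GRing.isLinear.Build k A2 A3 _ (@leg2 k A i j) (leg2_linear i j).

Fact leg3_linear i j l : linear (@leg3 k A i j l).
Proof.
apply: tlift_linear => [b|a] c x y; first by rewrite linearP mulrDl scalerAl.
by rewrite linearP mulrDr scalerAr.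
Qed.
HB.instance Definition _ i j l :=
  GRing.isLinear.Build k A3 A3 _ (@leg3 k A i j l) (leg3_linear i j l).

Lemma leg3_pure2 i j l (x : A2) (c : A) :
  leg3 i j l (x ⊗ c) = leg2 i j x * slot l c.
Proof. exact: (tlift_pure (@leg3_balanced k A i j l)). Qed.

Lemma leg2_slotC i j l (x : A2) (c : A) : slots i l -> slots j l ->
  leg2 i j x * slot l c = slot l c * leg2 i j x.
Proof.
move=> il jl; elim/(@tens_ind k A A): x => [|a b|x y IHx IHy].
- by rewrite !linear0 mul0r mulr0.
- by rewrite leg2_pure -mulrA (slotC _ _ jl) !mulrA (slotC _ _ il).
- by rewrite linearD mulrDl mulrDr IHx IHy.
Qed.

(** Elements in distinct slots commute, so the inner factors of a product can be exchanged. *)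
Lemma leg2_monoid_morphism i j : slots i j -> monoid_morphism (@leg2 k A i j).
Proof.
move=> ij; apply: tens_monoid_morphism => [|a b a' b'] /=.
  by rewrite -tpure1 leg2_pure !slot1 mul1r.
rewrite !leg2_pure !slotM !mulrA; congr (_ * _).
by rewrite -!mulrA (slotC _ _ ij).
Qed.

Lemma leg3_monoid_morphism i j l : slots i j -> slots i l -> slots j l ->
  monoid_morphism (@leg3 k A i j l).
Proof.
move=> ij il jl; have [l1 lM] := leg2_monoid_morphism ij.
apply: tens_monoid_morphism => [|x c x' c'] /=.
  by rewrite -tpure1 leg3_pure2 slot1 l1 mul1r.
rewrite !leg3_pure2 lM slotM !mulrA; congr (_ * _).
by rewrite -!mulrA leg2_slotC.
Qed.

Lemma leg2_flip i j (x : A2) : slots i j -> leg2 i j (tflip x) = leg2 j i x.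
Proof.
move=> ij; elim/(@tens_ind k A A): x => [|a b|x y IHx IHy].
- by rewrite !linear0.
- by rewrite tflip_pure !leg2_pure slotC.
- by rewrite !linearD /= IHx IHy.
Qed.

Lemma leg2_12 (x : A2) : leg2 1 2 x = x ⊗ 1.
Proof.
elim/(@tens_ind k A A): x => [|a b|x y IHx IHy].
  by rewrite linear0 tpure0l.
  by rewrite leg2_pure /= !tpureM !mulr1 mul1r.
by rewrite linearD tpureDl /= IHx IHy.
Qed.

Lemma leg2_23 (x : A2) : leg2 2 3 x = one_tens2 x.
Proof.
elim/(@tens_ind k A A): x => [|a b|x y IHx IHy]; first by rewrite !linear0.
  by rewrite leg2_pure /= !tpureM !mulr1 !mul1r /one_tens2 tassoc_pure.
by rewrite !linearD /= IHx IHy.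
Qed.

Lemma leg3_123 (x : A3) : leg3 1 2 3 x = x.
Proof.
elim/(@tens_ind k A2 A): x => [|a b|x y IHx IHy]; first by rewrite !linear0.
  by rewrite leg3_pure2 leg2_12 /= tpureM mulr1 mul1r.
by rewrite !linearD /= IHx IHy.
Qed.

Lemma leg3_tens1 i j l (x : A2) : leg3 i j l (x ⊗ 1) = leg2 i j x.
Proof. by rewrite leg3_pure2 slot1 mulr1. Qed.

Lemma leg3_tassoc i j l a (x : A2) :
  leg3 i j l (tassoc (a ⊗ x)) = slot i a * leg2 j l x.
Proof.
elim/(@tens_ind k A A): x => [|b c|x y IHx IHy].
- by rewrite !linear0 mulr0.
- by rewrite tassoc_pure leg3_pure leg2_pure mulrA.
- by rewrite !linearD /= mulrDr IHx IHy.
Qed.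

Lemma leg3_one_tens2 i j l (x : A2) : leg3 i j l (one_tens2 x) = leg2 j l x.
Proof. by rewrite leg3_tassoc slot1 mul1r. Qed.

Section Coproduct.
Variable D : {lrmorphism A -> (A ⊗ A)%type}.

(** The cyclic permutation carries the coproduct of the second leg into slots 1 and 2. This
    identifies (Δ ⊗ id)F^op with a permuted copy of (id ⊗ Δ)F in the second hexagon. *)
Lemma leg3_312_id_D (x : A2) : leg3 3 1 2 (id_D D x) = D_id D (tflip x).
Proof.
elim/(@tens_ind k A A): x => [|a b|x y IHx IHy]; first by rewrite !linear0.
  rewrite tflip_pure id_D_pure D_id_pure leg3_tassoc leg2_12 /=.
  by rewrite tpureM mul1r mulr1.
by rewrite !linearD /= IHx IHy.
Qed.

Lemma leg3_231_D_id (x : A2) : leg3 2 3 1 (D_id D x) = id_D D (tflip x).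
Proof.
elim/(@tens_ind k A A): x => [|a b|x y IHx IHy]; first by rewrite !linear0.
  rewrite tflip_pure id_D_pure D_id_pure leg3_pure2 leg2_slotC //.
  by rewrite -[tassoc _]leg3_123 leg3_tassoc.
by rewrite !linearD /= IHx IHy.
Qed.

Section RMatrix.
Variable R : A2.
Hypothesis RD : forall a, tflip (D a) * R = R * D a.

(** The coproduct of the first leg of [x] sits in slots i and j, where Δ^op R = R Δ applies; the
    second leg, in slot l, commutes with R_ij. *)
Lemma R_D_id i j l x : slots i j -> slots i l -> slots j l ->
  leg2 i j R * leg3 i j l (D_id D x) = leg3 j i l (D_id D x) * leg2 i j R.
Proof.
move=> ij il jl; have [_ lM] := leg2_monoid_morphism ij.
elim/(@tens_ind k A A): x => [|a b|x y IHx IHy].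
- by rewrite !linear0 mul0r mulr0.
- rewrite D_id_pure !leg3_pure2 mulrA -lM -RD lM leg2_flip // -!mulrA.
  by rewrite leg2_slotC.
- by rewrite !linearD /= mulrDl mulrDr IHx IHy.
Qed.

Lemma R_id_D i j l x : slots i j -> slots i l -> slots j l ->
  leg2 j l R * leg3 i j l (id_D D x) = leg3 i l j (id_D D x) * leg2 j l R.
Proof.
move=> ij il jl; have [_ lM] := leg2_monoid_morphism jl.
elim/(@tens_ind k A A): x => [|a b|x y IHx IHy].
- by rewrite !linear0 mul0r mulr0.
- rewrite id_D_pure !leg3_tassoc mulrA leg2_slotC 1?slots_sym //.
  by rewrite -mulrA -lM -RD lM leg2_flip // mulrA.
- by rewrite !linearD /= mulrDl mulrDr IHx IHy.
Qed.
End RMatrix.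
End Coproduct.

End Legs.

(** * Counit maps and the unit constraints *)

Section Counit.
Variables (k : fieldType) (A : unitAlgType k) (e : {lrmorphism A -> k^o}).
Local Notation A2 := (A ⊗ A)%type.
Local Notation A3 := (A ⊗ A ⊗ A)%type.

Section Maps.
Variable V : algType k.

Fact e_id_linear : linear (@e_id k A V e).
Proof.
apply: tlift_linear => [w|v] c x y; first by rewrite linearP scalerDl -scalerA.
by rewrite scalerDr !scalerA mulrC.
Qed.
HB.instance Definition _ :=
  GRing.isLinear.Build k (A ⊗ V)%type V _ (@e_id k A V e) e_id_linear.

Fact id_e_linear : linear (@id_e k A V e).
Proof.
apply: tlift_linear => [w|v] c x y; first by rewrite scalerDr !scalerA mulrC.
by rewrite linearP scalerDl -scalerA.
Qed.
HB.instance Definition _ :=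
  GRing.isLinear.Build k (V ⊗ A)%type V _ (@id_e k A V e) id_e_linear.

Lemma e_id_pure a (v : V) : e_id e (a ⊗ v) = e a *: v.
Proof.
apply: tlift_pure; split=> [x y w|x w w'|c x w].
- by rewrite linearD scalerDl.
- by rewrite scalerDr.
- by rewrite linearZ /= scalerA mulrC.
Qed.

Lemma id_e_pure a (v : V) : id_e e (v ⊗ a) = e a *: v.
Proof.
apply: tlift_pure; split=> [x y w|x w w'|c x w].
- by rewrite scalerDr.
- by rewrite linearD scalerDl.
- by rewrite scalerA [e (c *: w)]linearZ mulrC.
Qed.

Fact e_id_monoid_morphism : monoid_morphism (@e_id k A V e).
Proof.
apply: tens_monoid_morphism => [|a v a' v'] /=.
  by rewrite -tpure1 e_id_pure rmorph1 scale1r.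
by rewrite !e_id_pure rmorphM -scalerAl -scalerAr scalerA.
Qed.
HB.instance Definition _ := GRing.isMonoidMorphism.Build (A ⊗ V)%type V
  (@e_id k A V e) e_id_monoid_morphism.

Fact id_e_monoid_morphism : monoid_morphism (@id_e k A V e).
Proof.
apply: tens_monoid_morphism => [|v a v' a'] /=.
  by rewrite -tpure1 id_e_pure rmorph1 scale1r.
by rewrite !id_e_pure rmorphM -scalerAl -scalerAr scalerA.
Qed.
HB.instance Definition _ := GRing.isMonoidMorphism.Build (V ⊗ A)%type V
  (@id_e k A V e) id_e_monoid_morphism.
End Maps.

Let I : {lrmorphism A -> A} := idfun.

HB.instance Definition _ :=
  GRing.LRMorphism.copy (@id_e_id k A e) (tmap (@id_e k A A e) I).

Lemma id_e_id_pure (x : A2) b : id_e_id e (x ⊗ b) = id_e e x ⊗ b.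
Proof. exact: (tmap_pure (@id_e k A A e) I). Qed.

Lemma id_e_id_tassoc a (x : A2) : id_e_id e (tassoc (a ⊗ x)) = a ⊗ e_id e x.
Proof.
elim/(@tens_ind k A A): x => [|b c|x y IHx IHy]; first by rewrite !linear0.
  by rewrite tassoc_pure id_e_id_pure id_e_pure e_id_pure tpureZl tpureZr.
by rewrite !linearD /= IHx IHy.
Qed.

(** With [e_e_idE], this lets the triangle element (id ⊗ ε ⊗ id)Φ determine both unit
    constraints. *)
Lemma id_e_eE (x : A3) : id_e_e e x = id_e e (id_e_id e x).
Proof.
rewrite /id_e_e; elim/(@tens_ind k A2 A): x => [|x b|x y IHx IHy].
- by rewrite !linear0.
- by rewrite id_e_id_pure !id_e_pure linearZ.
- by rewrite !linearD /= IHx IHy.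
Qed.

(** Both sides are (ε ⊗ ε)x; for [x = F] this is ε(u) = ε(v). *)
Lemma counit_e_id (x : A2) : e (e_id e x) = e (id_e e x).
Proof.
elim/(@tens_ind k A A): x => [|a c|x y IHx IHy]; first by rewrite !linear0.
  by rewrite e_id_pure id_e_pure !linearZ; exact: mulrC.
by rewrite !linearD /= IHx IHy.
Qed.

Lemma e_e_idE (x : A3) : e_e_id e x = e_id e (id_e_id e x).
Proof.
rewrite /e_e_id; elim/(@tens_ind k A2 A): x => [|x b|x y IHx IHy].
- by rewrite !linear0 /= (linear0 (tmap (@e_id k A A e) I)) !linear0.
- rewrite (tmap_pure (@e_id k A A e) I) /= id_e_id_pure !e_id_pure.
  congr (_ *: _).
  exact: counit_e_id.
- by rewrite !linearD /= (linearD (tmap (@e_id k A A e) I)) linearD /= IHx IHy.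
Qed.

(** * The triangle and the normalized unit constraints of the twist *)

Section Twist.
Variables (D : {lrmorphism A -> A2}) (cr cl : A) (F : A2) (P Q : A3).
Hypotheses (ul : cl \is a GRing.unit) (ur : cr \is a GRing.unit).
Hypothesis uF : F \is a GRing.unit.
Hypothesis counitl : forall a, e_id e (D a) = cl^-1 * a * cl.
Hypothesis counitr : forall a, id_e e (D a) = cr^-1 * a * cr.
Hypothesis triangle : id_e_id e P = cr ⊗ cl^-1.
Hypothesis PQ : Q * (F ⊗ 1) * D_id D F = one_tens2 F * id_D D F * P.

Let u := e_id e F.
Let v := id_e e F.

Lemma id_e_id_D_id x : (cr ⊗ 1) * id_e_id e (D_id D x) = x * (cr ⊗ 1).
Proof.
elim/(@tens_ind k A A): x => [|a b|x y IHx IHy].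
- by rewrite !linear0 mulr0 mul0r.
- rewrite D_id_pure id_e_id_pure counitr !tpureM !mulrA mulrV //.
  by rewrite !mul1r mulr1.
- by rewrite !linearD /= mulrDl mulrDr IHx IHy.
Qed.

Lemma id_e_id_id_D x : id_e_id e (id_D D x) * (1 ⊗ cl^-1) = (1 ⊗ cl^-1) * x.
Proof.
elim/(@tens_ind k A A): x => [|a b|x y IHx IHy].
- by rewrite !linear0 mulr0 mul0r.
- rewrite id_D_pure id_e_id_tassoc counitl !tpureM mulrK //.
  by rewrite !mul1r mulr1.
- by rewrite !linearD /= mulrDl mulrDr IHx IHy.
Qed.

(** Apply id ⊗ ε ⊗ id to [PQ]. The counit axioms turn both coproducts of [F] into conjugates of [F],
    by [cr] in the first leg and by [cl] in the second, so that [F] cancels. *)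
Lemma triangle_twist : id_e_id e Q = (cr * v^-1) ⊗ (u * cl^-1).
Proof.
have uv : v \is a GRing.unit by apply: rmorph_unit.
have uc1 : (cr : A) ⊗ (1 : A) \is a GRing.unit.
  by apply/unitrP; exists (cr^-1 ⊗ 1); rewrite !tpureM mulVr ?mulrV ?mulr1.
have uc2 : ((v * cr^-1 : A) ⊗ (1 : A)) \is a GRing.unit.
  apply/unitrP; exists ((cr * v^-1) ⊗ 1).
  by rewrite !tpureM !mulrA mulrVK ?mulrV ?mulrVK ?mulrV ?mulr1.
have := congr1 (id_e_id e) PQ; rewrite !rmorphM /= triangle.
rewrite id_e_id_pure [in RHS]/one_tens2 id_e_id_tassoc -/u -/v => H.
(* The three cancelled factors multiply to [(v ⊗ 1) * id_e_id e (D_id D F)], the factor that follows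
   [id_e_id e Q] in [H]. *)
apply: (mulIr uc2); apply: (mulIr uF); apply: (mulIr uc1).
transitivity (id_e_id e Q * (v ⊗ 1) * id_e_id e (D_id D F)).
  rewrite -!mulrA -id_e_id_D_id !mulrA; congr (_ * _); rewrite -!mulrA tpureM.
  by rewrite mulrVK ?mulr1.
rewrite H -!mulrA; have -> : cr ⊗ cl^-1 = (1 ⊗ cl^-1) * (cr ⊗ 1).
  by rewrite tpureM mul1r mulr1.
rewrite (mulrA (id_e_id e _)) id_e_id_id_D !mulrA !tpureM !mulrA.
by rewrite mulrVK // mulrV // !mulr1.
Qed.

Hypotheses (nr : e cr = 1) (nl : e cl = 1).

Let w := e u.

Lemma e_twist_unit : w \is a GRing.unit.
Proof. by rewrite !rmorph_unit. Qed.

(** The scalar is ε(u cl^-1), which is [w] because ε(cl) = 1. *)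
Lemma cr_of_twist : cr_of e Q = w *: (cr * v^-1).
Proof.
rewrite /cr_of id_e_eE triangle_twist id_e_pure.
by rewrite rmorphM /= rmorphV //= nl divr1.
Qed.

(** The first leg of the triangle element contributes ε(cr v^-1) = w^-1, and [cl_of] inverts the
    result. *)
Lemma cl_of_twist : cl_of e Q = w *: (cl * u^-1).
Proof.
have uu : u \is a GRing.unit by apply: rmorph_unit.
have uv : v \is a GRing.unit by apply: rmorph_unit.
rewrite /cl_of e_e_idE triangle_twist e_id_pure rmorphM /= rmorphV //= nr mul1r.
rewrite -counit_e_id -/w invrZ ?unitrV ?e_twist_unit ?unitrMl ?unitrV //.
by rewrite invrK invrM ?unitrV // invrK.
Qed.
End Twist.
End Counit.

(* Product identities in a form that rewrites inside right-nested products. *)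
Lemma mulr2z (S : pzRingType) (x y l : S) :
  x * y = l -> forall z, x * (y * z) = l * z.
Proof. by move=> e z; rewrite mulrA e. Qed.

Lemma mulr3z (S : pzRingType) (x y t l : S) :
  x * y * t = l -> forall z, x * (y * (t * z)) = l * z.
Proof. by move=> e z; rewrite !mulrA e. Qed.

(** * Coassociativity, pentagon and counit axioms for the twist *)

Section Twist.
Variables (k : fieldType) (A : unitAlgType k).
Local Notation A2 := (A ⊗ A)%type.
Local Notation A3 := (A ⊗ A ⊗ A)%type.
Variables (D E : {lrmorphism A -> (A ⊗ A)%type}) (F : A ⊗ A) (P Q : A3).
Hypothesis uF : F \is a GRing.unit.
Hypothesis DE : forall a, E a * F = F * D a.
Hypothesis PQ : Q * (F ⊗ 1) * D_id D F = one_tens2 F * id_D D F * P.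

Lemma tpure1_unit (V W : algType k) (x : V ⊗ W) :
  x \is a GRing.unit -> x ⊗ (1 : A) \is a GRing.unit.
Proof.
by move=> ux; exact: (monoid_morphism_unit (tpure1_monoid_morphism _ A) ux).1.
Qed.

Lemma twist_unit : P \is a GRing.unit -> Q \is a GRing.unit.
Proof.
move=> uP; have uF1 := tpure1_unit uF.
have uY : D_id D F \is a GRing.unit by rewrite rmorph_unit.
rewrite -(unitrMl _ uF1) -(unitrMl _ uY) PQ.
by rewrite unitrMr // unitrMr rmorph_unit.
Qed.

Lemma coassoc_twist :
  (forall a, id_D D (D a) * P = P * D_id D (D a)) ->
  forall a, id_D E (E a) * Q = Q * D_id E (E a).
Proof.
move=> coassoc a; have uF1 := tpure1_unit uF.
have uY : D_id D F \is a GRing.unit by rewrite rmorph_unit.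
(* The trailing [1] supplies the tail [z] expected by the rewriting rules on right-nested
   products. *)
have uG : (F ⊗ 1) * (D_id D F * 1) \is a GRing.unit by rewrite unitrMl ?mulr1.
have PQz z : Q * ((F ⊗ 1) * (D_id D F * z)) =
    one_tens2 F * (id_D D F * (P * z)).
  by rewrite !mulrA PQ.
(* [DE] is used twice: to pass the outer copy of [F], and under [D_id D] to pass the inner one. *)
have Yz z : D_id E (E a) * ((F ⊗ 1) * (D_id D F * z)) =
    (F ⊗ 1) * (D_id D F * (D_id D (D a) * z)).
  rewrite (mulrA (D_id E _)) (D_id_conj DE).
  by rewrite -!mulrA (mulrA (D_id D _)) -rmorphM DE rmorphM -mulrA.
have Xz z : id_D E (E a) * (one_tens2 F * (id_D D F * z)) =
    one_tens2 F * (id_D D F * (id_D D (D a) * z)).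
  rewrite (mulrA (id_D E _)) (id_D_conj DE).
  by rewrite -!mulrA (mulrA (id_D D _)) -rmorphM DE rmorphM -mulrA.
apply: (mulIr uG); rewrite -!mulrA PQz Xz Yz PQz.
by rewrite !mulr1 coassoc.
Qed.

Lemma pentagon_twist :
  (forall a, id_D D (D a) * P = P * D_id D (D a)) ->
  id_id_D D P * D_id_id D P = one_tens3 P * id_D_id D P * (P ⊗ 1) ->
  id_id_D E Q * D_id_id E Q = one_tens3 Q * id_D_id E Q * (Q ⊗ 1).
Proof.
move=> coassoc pentagon; have uF1 := tpure1_unit uF.
have uF2 := tpure1_unit uF1.
have uY : D_id D F \is a GRing.unit by rewrite rmorph_unit.
have uY1 := tpure1_unit uY.
have uYb : D_id_id D (D_id D F) \is a GRing.unit by rewrite rmorph_unit.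
(* The copies of [F] attached to the bracketing ((12)3)4, where both paths of the pentagon start. *)
have uG : (F ⊗ 1 ⊗ 1) * ((D_id D F ⊗ 1) * (D_id_id D (D_id D F) * 1))
    \is a GRing.unit by rewrite mulr1 unitrMr ?unitrMr.
(* The five images of [PQ] correspond to the five edges of the pentagon. *)
have := congr1 (id_id_D D) PQ; rewrite !rmorphM /= id_id_D_tens1 id_id_D_D_id.
have := congr1 (D_id_id D) PQ.
rewrite !rmorphM /= D_id_id_pure D_id_id_one_tens2 -id_id_D_D_id.
have := congr1 (@one_tens3 k A) PQ.
rewrite !rmorphM /= one_tens3_tens1 one_tens3_id_D one_tens3_D_id.
have := congr1 (id_D_id D) PQ; rewrite !rmorphM /= id_D_id_pure.
have [_ tM] := tpure1_monoid_morphism A3 A.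
have := congr1 (fun x : A3 => x ⊗ (1 : A)) PQ; rewrite /= !tM.
move=> pPQ cPQ oPQ bPQ aPQ.
have aX := coassoc_id_D coassoc F; have cY := coassoc_D_id coassoc F.
have aQ := id_id_D_conj DE Q; have bQ := D_id_id_conj DE Q.
have cQ := id_D_id_conj DE Q; have F1234 := tens12_34_comm F F.
apply: (mulIr uG); rewrite -!mulrA.
(* The path through (12)(34), where the copies of [F] in legs 1, 2 and 3, 4 have to be exchanged;
   the pentagon for [P] is used at its end. *)
rewrite (mulr2z bQ) -!mulrA (mulr3z bPQ) -!mulrA (mulr2z F1234) -!mulrA.
rewrite (mulr2z aQ) -!mulrA (mulr3z aPQ) -!mulrA (mulr2z pentagon) -!mulrA.
(* The path through (1(23))4 and 1((23)4); [cY] and [aX] pass the associators through iterated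
   coproducts of [F]. *)
rewrite (mulr3z pPQ) -!mulrA (mulr2z (esym cY)) -!mulrA (mulr2z cQ) -!mulrA.
by rewrite (mulr3z cPQ) -!mulrA (mulr3z oPQ) -!mulrA (mulr2z (esym aX)) -!mulrA.
Qed.

(** Meant for f = ε ⊗ id and f = id ⊗ ε. Applying [f] to [DE] conjugates by [f F], and the central
    scalar [w] cancels. *)
Lemma conj_twist (f : {lrmorphism (A ⊗ A)%type -> A}) (c : A) (w : k) :
  c \is a GRing.unit -> w \is a GRing.unit ->
  (forall a, f (D a) = c^-1 * a * c) ->
  forall a, f (E a) = (w *: (c * (f F)^-1))^-1 * a * (w *: (c * (f F)^-1)).
Proof.
move=> uc uw fD a; have uf : f F \is a GRing.unit by rewrite rmorph_unit.
rewrite invrZ ?unitrMl ?unitrV // -scalerAr -!scalerAl scalerA divrr // scale1r.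
rewrite invrM ?unitrV // invrK; apply: (mulIr uf).
have := congr1 f (DE a); rewrite !rmorphM /= fD => ->.
by rewrite !mulrA mulrVK.
Qed.

(** * The hexagons for the twisted R-matrix *)

Section RMatrix.
Variables R S : A2.
Hypothesis RD : forall a, tflip (D a) * R = R * D a.
Hypothesis SF : S * F = tflip F * R.

Let G := (F ⊗ 1) * D_id D F.
Let H := one_tens2 F * id_D D F.

Lemma leg3_twist i j l : slots i j -> slots i l -> slots j l ->
  leg3 i j l Q * leg3 i j l G = leg3 i j l H * leg3 i j l P.
Proof.
move=> ij il jl; have [_ lM] := leg3_monoid_morphism A ij il jl.
by rewrite -!lM /G mulrA PQ.
Qed.

(** Passing the outer copy of [F] turns [S] into [R] by [SF]; then [R] passes the coproduct by
    [R_D_id]. *)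
Lemma R_twist_l i j l : slots i j -> slots i l -> slots j l ->
  leg2 i j S * leg3 i j l G = leg3 j i l G * leg2 i j R.
Proof.
move=> ij il jl; have [_ lM] := leg3_monoid_morphism A ij il jl.
have ji := ij; rewrite slots_sym in ji.
have [_ lM'] := leg3_monoid_morphism A ji jl il.
have [_ lM2] := leg2_monoid_morphism A ij.
rewrite lM lM' !leg3_tens1 mulrA -lM2 SF lM2 leg2_flip //.
by rewrite -!mulrA (R_D_id RD).
Qed.

Lemma R_twist_r i j l : slots i j -> slots i l -> slots j l ->
  leg2 j l S * leg3 i j l H = leg3 i l j H * leg2 j l R.
Proof.
move=> ij il jl; have [_ lM] := leg3_monoid_morphism A ij il jl.
have lj := jl; rewrite slots_sym in lj.
have [_ lM'] := leg3_monoid_morphism A il ij lj.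
have [_ lM2] := leg2_monoid_morphism A jl.
rewrite lM lM' !leg3_one_tens2 mulrA -lM2 SF lM2 leg2_flip //.
by rewrite -!mulrA (R_id_D RD).
Qed.

Hypothesis uP : P \is a GRing.unit.

Let uQ : Q \is a GRing.unit := twist_unit uP.

Let uG : G \is a GRing.unit.
Proof.
by rewrite unitrMr ?tpure1_unit // rmorph_unit.
Qed.

Let uH : H \is a GRing.unit.
Proof. by rewrite unitrMr rmorph_unit. Qed.

Lemma leg3_twistV i j l : slots i j -> slots i l -> slots j l ->
  (leg3 i j l Q)^-1 * leg3 i j l H = leg3 i j l G * (leg3 i j l P)^-1.
Proof.
move=> ij il jl; have l3 := leg3_monoid_morphism A ij il jl.
have [uQ' _] := monoid_morphism_unit l3 uQ.
have [uP' _] := monoid_morphism_unit l3 uP.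
by apply: (mulrI uQ'); rewrite mulVKr // mulrA leg3_twist // mulrK.
Qed.

Lemma D_id_R_twist :
  D_id D R = leg3 3 1 2 P * leg2 1 3 R * (leg3 1 3 2 P)^-1 * leg2 2 3 R
      * leg3 1 2 3 P ->
  D_id E S = leg3 3 1 2 Q * leg2 1 3 S * (leg3 1 3 2 Q)^-1 * leg2 2 3 S
      * leg3 1 2 3 Q.
Proof.
move=> DR; apply: (mulIr uG).
rewrite [in LHS]/G mulrA (D_id_conj DE) -[in LHS]mulrA.
rewrite -rmorphM SF rmorphM /= DR.
(* On the left, (F ⊗ 1)((Δ ⊗ id)F^op) is the copy H_312. *)
rewrite -leg3_312_id_D -leg2_12 -(@leg3_one_tens2 _ _ 3 1 2) mulrA.
have [_ <-] := @leg3_monoid_morphism _ A 3 1 2 isT isT isT; rewrite -/H.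
(* On the right, [G] moves leftwards through the five factors and becomes in turn H_123, H_132,
   G_132, G_312 and H_312. *)
rewrite -[in RHS](leg3_123 G) -!mulrA leg3_twist //.
rewrite (mulr2z (R_twist_r _ _ _)) // -!mulrA.
rewrite (mulr2z (leg3_twistV _ _ _)) // -!mulrA.
rewrite (mulr2z (R_twist_l _ _ _)) // -!mulrA.
by rewrite (mulr2z (leg3_twist _ _ _)) // -!mulrA.
Qed.

Lemma id_D_R_twist :
  id_D D R = (leg3 2 3 1 P)^-1 * leg2 1 3 R * leg3 2 1 3 P * leg2 1 2 R
      * (leg3 1 2 3 P)^-1 ->
  id_D E S = (leg3 2 3 1 Q)^-1 * leg2 1 3 S * leg3 2 1 3 Q * leg2 1 2 S
      * (leg3 1 2 3 Q)^-1.
Proof.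
move=> DR; apply: (mulIr uH).
rewrite [in LHS]/H mulrA (id_D_conj DE) -[in LHS]mulrA.
rewrite -rmorphM SF rmorphM /= DR.
rewrite -leg3_231_D_id -leg2_23 -(@leg3_tens1 _ _ 2 3 1) mulrA.
have [_ <-] := @leg3_monoid_morphism _ A 2 3 1 isT isT isT; rewrite -/G.
(* Here [H] becomes in turn G_123, G_213, H_213, H_231 and G_231, the last being the copy on the
   left. *)
rewrite -[in RHS](leg3_123 H) -!mulrA leg3_twistV //.
rewrite (mulr2z (R_twist_l _ _ _)) // -!mulrA.
rewrite (mulr2z (leg3_twist _ _ _)) // -!mulrA.
rewrite (mulr2z (R_twist_r _ _ _)) // -!mulrA.
by rewrite (mulr2z (leg3_twistV _ _ _)) // -!mulrA.
Qed.

End RMatrix.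
End Twist.

(** * Bundling the structure maps and collecting the axioms *)

Lemma lrmorphism_of (k : fieldType) (A B : algType k) (f : A -> B) :
  linear f -> monoid_morphism f -> exists g : {lrmorphism A -> B}, f = g.
Proof.
move=> fl fm.
pose li := GRing.isLinear.Build k A B _ f fl.
pose mi := GRing.isMonoidMorphism.Build A B f fm.
by exists (HB.pack_for {lrmorphism A -> B} f li mi).
Qed.

Theorem proposition1p7 (k : fieldType) (A : unitAlgType k)
    (Delta : A -> A ⊗ A) (eps : A -> k) (Phi : A ⊗ A ⊗ A) (R F : A ⊗ A)
    (DeltaF : A -> A ⊗ A) (PhiF : A ⊗ A ⊗ A) (RF : A ⊗ A) :
  is_quasi_triangular Delta eps Phi R ->
  F \is a GRing.unit ->
  (forall a, DeltaF a = F * Delta a * F^-1) ->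
  PhiF * (F ⊗ 1) * D_id Delta F = one_tens2 F * id_D Delta F * Phi ->
  RF = tflip F * R * F^-1 ->
  is_quasi_triangular DeltaF eps PhiF RF.
Proof.
case=> -[[Dl Dm el em uP ucr ucl coassoc pentagon counitl counitr triangle]
  ncr ncl] uR Rop Rr Rl uF DF PF RFE.
have DFl : linear DeltaF.
  by move=> c x y; rewrite !DF Dl mulrDr mulrDl -scalerAr -scalerAl.
have DFm : monoid_morphism DeltaF.
  split=> [|x y]; first by rewrite DF Dm.1 mulr1 mulrV.
  by rewrite !DF Dm.2 !mulrA mulrVK.
(* The bare functions are replaced by bundled morphisms; for the counit, the target is [k^o], the
   field as an algebra over itself. *)
have [D DD] := lrmorphism_of Dl Dm.
have [E EE] := lrmorphism_of DFl DFm.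
have [e ee] := @lrmorphism_of k A k^o eps el em.
subst Delta DeltaF eps.
have DE a : E a * F = F * D a by rewrite DF mulrVK.
have PQ : PhiF * (F ⊗ 1) * D_id D F = one_tens2 F * id_D D F * Phi by [].
have SF : RF * F = tflip F * R by rewrite RFE mulrVK.
have coassocD a : id_D D (D a) * Phi = Phi * D_id D (D a).
  by rewrite coassoc mulrVK.
have uQ := twist_unit uF PQ uP.
have uu : e_id e F \is a GRing.unit by rewrite rmorph_unit.
have uv : id_e e F \is a GRing.unit by rewrite rmorph_unit.
have uw : e (e_id e F) \is a GRing.unit := e_twist_unit e uF.
have crE := cr_of_twist ucl ucr uF counitl counitr triangle PQ ncl.
have clE := cl_of_twist ucl ucr uF counitl counitr triangle PQ ncr.
have triQ := triangle_twist ucl ucr uF counitl counitr triangle PQ.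
split.
- split.
  + split=> //.
    * by rewrite crE scaler_unit // unitrMr // unitrV.
    * by rewrite clE scaler_unit // unitrMr // unitrV.
    * by move=> a; rewrite -(coassoc_twist uF DE PQ coassocD) mulrK.
    * exact: (pentagon_twist uF DE PQ coassocD pentagon).
    * rewrite clE; exact: (conj_twist uF DE).
    * rewrite crE; exact: (conj_twist uF DE).
    * rewrite triQ crE clE; move: (ucl).
      (* [cl_of] unfolds to an inverse, on which [unitrV] and [invrK] would act. *)
      move: (cl_of e Phi) (cr_of e Phi) => cl cr ucl'.
      rewrite invrZ; [|exact: uw|by rewrite unitrMl ?unitrV].
      rewrite invrM ?unitrV // invrK.
      (* The scalars [w] and [w^-1] of the two legs cancel. *)
      by rewrite tpureZl tpureZr scalerA divrr // scale1r.
  (* The value is w ε(v)^-1, which is 1 since ε(v) = ε(u) = w. *)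
  + rewrite crE linearZ /= rmorphM rmorphV //= ncr mul1r -counit_e_id.
    exact: divrr.
  + rewrite clE linearZ /= rmorphM /= ncl mul1r rmorphV //.
    exact: divrr.
- by rewrite RFE !unitrMr ?unitrV ?rmorph_unit.
- move=> a; apply: (mulIr uF); rewrite -[LHS]mulrA SF mulrA.
  rewrite -rmorphM DE rmorphM /=.
  by rewrite -!mulrA Rop DE !mulrA SF.
- exact: (id_D_R_twist uF DE PQ Rop SF uP Rr).
- exact: (D_id_R_twist uF DE PQ Rop SF uP Rl).
Qed.
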